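(* Let $G$ be a connected unweighted graph of order $n\ge2$ with degrees $k_1,\dots,k_n$ and normalized adjacency eigenvalues $1=\lambda_1>\lambda_2\ge\cdots\ge\lambda_n$. Then $$K(G)\ \le\ \min_{i\sim j}\frac{\sqrt{k_ik_j}}{\sqrt{k_ik_j}+1}+\frac{n-2}{1-\lambda_2},$$ where the minimum is over all pairs of adjacent vertices $i\sim j$. Equality holds if and only if $G\cong K_n$.
   Context: Graphs are finite, simple, connected and undirected, with $n$ vertices; unweighted means all edge weights are $1$. $A$ is the adjacency matrix and $D=\operatorname{diag}(k_1,\dots,k_n)$; the normalized adjacency matrix is $D^{-1/2}AD^{-1/2}$. $K_n$ is the complete graph on $n$ vertices. Kemeny's constant is $K(G)=\sum_i\pi_i m_{ji}-1$ for the random walk with transition matrix $D^{-1}A$, where $\pi$ is the stationary distribution and $m_{ji}$ the mean first passage time from $j$ to $i$ (with $m_{jj}$ the mean first return time); this does not depend on $j$, and it is known that $K(G)=\sum_{j=2}^{n}\frac{1}{1-\lambda_j}$. *)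

(* Defs.v *)
From HB Require Import structures.
From mathcomp Require Import all_boot all_order all_algebra.
From mathcomp Require Import all_classical all_reals.
From mathcomp Require Import ereal topology normedtype sequences.

Set Implicit Arguments.
Unset Strict Implicit.
Unset Printing Implicit Defensive.

Import Order.TTheory GRing.Theory Num.Theory.

Local Open Scope ring_scope.

(* A simple graph is a symmetric irreflexive relation e on a finite type.
   Graphs of order n have vertex type 'I_n. *)

Definition simple_graph (T : finType) (e : rel T) : Prop :=
  symmetric e /\ irreflexive e.

Definition connected_graph (T : finType) (e : rel T) : Prop :=
  forall x y : T, connect e x y.

Definition graph_iso (T1 T2 : finType) (e1 : rel T1) (e2 : rel T2) : Prop :=
  exists f : T1 -> T2, bijective f /\ forall x y, e2 (f x) (f y) = e1 x y.

Definition complete_graph (n : nat) : rel 'I_n := fun x y => x != y.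

Definition degree (T : finType) (e : rel T) (x : T) : nat :=
  #|[set y | e x y]|.

Definition adj_mx (R : realType) (n : nat) (e : rel 'I_n) : 'M[R]_n :=
  \matrix_(i, j) (e i j)%:R.

Definition degree_mx (R : realType) (n : nat) (e : rel 'I_n) : 'M[R]_n :=
  diag_mx (\row_i (degree e i)%:R).

Definition inv_sqrt_degree_mx (R : realType) (n : nat) (e : rel 'I_n) :
    'M[R]_n :=
  diag_mx (\row_i (Num.sqrt (degree e i)%:R)^-1).

Definition normalized_adj_mx (R : realType) (n : nat) (e : rel 'I_n) :
    'M[R]_n :=
  inv_sqrt_degree_mx R e *m adj_mx R e *m inv_sqrt_degree_mx R e.

Definition transition_mx (R : realType) (n : nat) (e : rel 'I_n) : 'M[R]_n :=
  invmx (degree_mx R e) *m adj_mx R e.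

(* s lists all eigenvalues of M with multiplicity, in nonincreasing order;
   s`_0 is lambda_1, s`_1 is lambda_2, and so on. *)
Definition ordered_spectrum (R : realType) (n : nat) (M : 'M[R]_n)
    (s : seq R) : Prop :=
  sorted >=%R s /\ char_poly M = \prod_(a <- s) ('X - a%:P).

Definition stationary_distribution (R : realType) (n : nat) (P : 'M[R]_n)
    (p : 'rV[R]_n) : Prop :=
  [/\ forall i, 0 <= p 0 i, \sum_i p 0 i = 1 & p *m P = p].

(* The probability that the chain started at x follows the states listed in w;
   the starting state x is not listed in w. *)
Fixpoint walk_prob (R : realType) (n : nat) (P : 'M[R]_n) (x : 'I_n)
    (w : seq 'I_n) : R :=
  if w is y :: w' then P x y * walk_prob P y w' else 1.

(* P_j(T_i = t), where T_i is the least s >= 1 with X_s = i.  The condition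
   on w says that its first occurrence of i is its last entry; it excludes
   t = 0, and X_0 = j is not constrained, so i = j gives the return time. *)
Definition first_passage_prob (R : realType) (n : nat) (P : 'M[R]_n)
    (j i : 'I_n) (t : nat) : R :=
  \sum_(w : t.-tuple 'I_n | (index i w).+1 == t) walk_prob P j w.

(* The expectation of T_i under P_j, for chains with T_i finite almost surely
   (in particular for irreducible finite chains): an event T_i = +oo of
   positive probability would not be accounted for. *)
Definition mean_first_passage (R : realType) (n : nat) (P : 'M[R]_n)
    (j i : 'I_n) : \bar R :=
  (\sum_(0 <= t <oo) (t%:R * first_passage_prob P j i t)%:E)%E.

(* Kemeny's constant computed from the starting vertex j and the stationary
   distribution p. *)
Definition kemeny (R : realType) (n : nat) (e : rel 'I_n) (p : 'rV[R]_n)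
    (j : 'I_n) : \bar R :=
  (\sum_i (p ord0 i)%:E * mean_first_passage (transition_mx R e) j i - 1)%E.

Definition edge_term (R : realType) (n : nat) (e : rel 'I_n) (i j : 'I_n) : R :=
  let s := Num.sqrt ((degree e i)%:R * (degree e j)%:R) in s / (s + 1).

(* Every edge_term is smaller than 1, so as soon as e has an edge the initial
   value 1 does not affect the minimum (see min_edge_termP). *)
Definition min_edge_term (R : realType) (n : nat) (e : rel 'I_n) : R :=
  \big[Num.min/1]_(p : 'I_n * 'I_n | e p.1 p.2) edge_term R e p.1 p.2.

Lemma edge_term_le1 (R : realType) (n : nat) (e : rel 'I_n) (i j : 'I_n) :
  edge_term R e i j <= 1.
Proof.
rewrite /edge_term /=; set s := Num.sqrt _.
have s0 : 0 <= s by exact: sqrtr_ge0.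
by rewrite ler_pdivrMr ?mul1r ?lerDl ?ltr_wpDl.
Qed.

Lemma min_edge_termP (R : realType) (n : nat) (e : rel 'I_n) (x y : 'I_n) :
  e x y ->
  (exists i j, e i j /\ min_edge_term R e = edge_term R e i j) /\
  (forall i j, e i j -> min_edge_term R e <= edge_term R e i j).
Proof.
move=> exy; split; last first.
  by move=> i j eij; apply: (@bigmin_le_cond _ _ _ _ (i, j)).
have [[i j] /= eij eq_min] := eq_bigmin (x := 1) (x, y)
  (fun p : 'I_n * 'I_n => e p.1 p.2) (fun p => edge_term R e p.1 p.2) exy
  (fun p _ => edge_term_le1 R e p.1 p.2).
by exists i, j.
Qed.

(* Main.v *)
(**
Let N be the normalized adjacency matrix and v the unit row vector with entries
proportional to the square roots of the degrees, so that v N = v.  The fundamental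
matrix Z = (1 - P + 1 p)^-1 gives every mean first passage time in closed form,
m_xi = ([x = i] - Z_xi + Z_ii) / p_i, and hence K = tr Z - 1.  As 1 - P + 1 p is
similar to 1 - (N - v^T v), and replacing N by N - v^T v turns one eigenvalue 1
into 0, this yields K = sum_(k >= 2) 1 / (1 - lambda_k).

For an edge i ~ k the unit vector x = (delta_i - delta_k) / sqrt 2 has
x N x^T = - 1 / sqrt (k_i k_k), so lambda_n <= - 1 / sqrt (k_i k_k); bounding the
other n - 2 terms by 1 / (1 - lambda_2) gives the inequality.

In the case of equality the spectrum is 1, c (n - 2 times), b with b = x N x^T for
the minimizing edge.  Put W = N - c - (1 - c) v^T v - (b - c) x^T x.  The traces
of N and N^2 give tr (W^2) = 2 (1 - c) (b - c) (v x^T)^2 <= 0, so W = 0.  Off the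
diagonal x^T x is nonpositive, hence all the corresponding entries of N are
positive and the graph is complete.
*)
Require Import Defs.
From HB Require Import structures.
From mathcomp Require Import all_boot all_order all_algebra.
From mathcomp Require Import all_classical all_reals.
From mathcomp Require Import ereal topology normedtype sequences.
From mathcomp Require Import spectral complex ring lra zify.

Set Implicit Arguments.
Unset Strict Implicit.
Unset Printing Implicit Defensive.

Import Order.TTheory GRing.Theory Num.Theory.
Import numFieldNormedType.Exports.

Local Open Scope ring_scope.

(** * Symmetric matrices whose characteristic polynomial splits *)

(** Over [R[i]] a real symmetric matrix is Hermitian, hence unitarily diagonalizable with real
    diagonal. Comparing the two factorizations of the characteristic polynomial identifies this
    diagonal with [s] up to order. *)
Lemma symmetric_spectral (R : rcfType) n (M : 'M[R]_n) (s : seq R) :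
  M^T = M -> char_poly M = \prod_(a <- s) ('X - a%:P) ->
  exists U : 'M[R[i]]_n, exists d : 'I_n -> R,
    [/\ U \is unitarymx, perm_eq [seq d i | i <- index_enum 'I_n] s &
     map_mx (real_complex R) M =
       invmx U *m diag_mx (\row_i (real_complex R (d i))) *m U].
Proof.
move=> Msym Mchar.
set C := map_mx _ M.
have Cherm : C \is hermsymmx.
  apply: realsym_hermsym.
    by apply/is_hermitianmxP; rewrite expr0 scale1r map_mx_id // map_trmx Msym.
  apply/mxOverP => i k; rewrite mxE; apply/complex_realP; by exists (M i k).
have/orthomx_spectralP CE := hermitian_normalmx Cherm.
have dreal := hermitian_spectral_diag_real Cherm.
pose d i := complex.Re (spectral_diag C 0 i).
have dE : spectral_diag C = \row_i (real_complex R (d i)).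
  apply/rowP => i; rewrite mxE /d RRe_real //; exact: (mxOverP dreal).
exists (spectralmx C), d; split; [exact: spectral_unitarymx | | by rewrite -dE].
have: char_poly C = \prod_(i < n) ('X - (real_complex R (d i))%:P).
  have Uu := spectral_unit C.
  rewrite /char_poly {1}CE /char_poly_mx.
  have -> : 'X%:M = map_mx polyC (invmx (spectralmx C)) *m 'X%:M *m
      map_mx polyC (spectralmx C).
    by rewrite -mulmxA -scalar_mxC mulmxA -map_mxM mulVmx // map_mx1 mul1mx.
  rewrite !map_mxM -mulmxBl -mulmxBr !det_mulmx mulrAC -det_mulmx -map_mxM mulVmx //.
  rewrite map_mx1 det1 mul1r dE map_diag_mx -diag_const_mx -raddfB det_diag.
  by apply: eq_bigr => i _; rewrite !mxE.
rewrite -map_char_poly Mchar rmorph_prod /= => prodE.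
have/prod_XsubC_eq :
    \prod_(x <- [seq real_complex R (d i) | i <- index_enum 'I_n]) ('X - x%:P) =
    \prod_(x <- [seq real_complex R a | a <- s]) ('X - x%:P).
  rewrite !big_map -prodE; apply: eq_bigr => a _.
  by rewrite map_polyXsubC.
rewrite (map_comp (real_complex R) d); exact/perm_map_inj/complexI.
Qed.

Section Diagonalized.
Variables (F C : fieldType) (f : {rmorphism F -> C}).
Variables (n : nat) (U : 'M[C]_n) (d : 'I_n -> F) (s : seq F).
Hypotheses (Uu : U \in unitmx) (ds : perm_eq [seq d i | i <- index_enum 'I_n] s).

(** Matrix and eigenvalues live in [F], the change of basis in [C] (later [R] and [R[i]]). As [U] is
    fixed, shifts, products and inverses act on the diagonals alone. *)
Definition diagonalizes (M : 'M[F]_n) (d : 'I_n -> F) :=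
  map_mx f M = invmx U *m diag_mx (\row_i f (d i)) *m U.

Lemma diagonalizes_trace M (g : F -> F) :
  diagonalizes M (g \o d) -> \tr M = \sum_(a <- s) g a.
Proof.
move=> ME; apply: (fmorph_inj f).
rewrite -trace_map_mx ME mxtrace_mulC mulmxA mulmxV // mul1mx mxtrace_diag.
rewrite -(perm_big _ ds) /= big_map rmorph_sum.
by apply: eq_bigr => i _; rewrite mxE.
Qed.

Lemma diagonalizes_shift M c : diagonalizes M d -> diagonalizes (c%:M - M) (fun i => c - d i).
Proof.
rewrite /diagonalizes => ME; rewrite map_mxB map_scalar_mx ME.
have -> : (f c)%:M = invmx U *m (f c)%:M *m U.
  by rewrite scalar_mxC -mulmxA mulVmx // mulmx1.
rewrite -mulmxBl -mulmxBr; congr (_ *m _ *m _).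
rewrite -diag_const_mx -raddfB; congr diag_mx.
by apply/rowP => i; rewrite !mxE rmorphB.
Qed.

Lemma diagonalizes_mul M1 M2 d1 d2 : diagonalizes M1 d1 -> diagonalizes M2 d2 ->
  diagonalizes (M1 *m M2) (fun i => d1 i * d2 i).
Proof.
rewrite /diagonalizes => M1E M2E; rewrite map_mxM M1E M2E !mulmxA mulmxK //.
congr (_ *m _); rewrite -mulmxA mulmx_diag; congr (_ *m diag_mx _).
by apply/rowP => i; rewrite !mxE rmorphM.
Qed.

Lemma diagonalizes_inv M Z d1 : (forall i, d1 i != 0) -> M *m Z = 1%:M ->
  diagonalizes M d1 -> diagonalizes Z (fun i => (d1 i)^-1).
Proof.
rewrite /diagonalizes => d1N0 MZ ME.
have MZ' : map_mx f M *m map_mx f Z = 1%:M by rewrite -map_mxM MZ map_mx1.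
have [Mu _] := mulmx1_unit MZ'.
apply: (can_inj (mulKmx Mu)); rewrite MZ' ME !mulmxA mulmxK //.
rewrite -(mulmxA (invmx U)) mulmx_diag -[LHS](mulVmx Uu).
congr (_ *m _); rewrite -[LHS]mulmx1; congr (_ *m _).
rewrite -diag_const_mx; congr diag_mx; apply/rowP => i.
by rewrite !mxE -rmorphM mulfV ?rmorph1.
Qed.

End Diagonalized.

Lemma symmetric_trace_sqr (R : rcfType) n (M : 'M[R]_n) (s : seq R) (c : R) :
  M^T = M -> char_poly M = \prod_(a <- s) ('X - a%:P) ->
  \tr ((M - c%:M) *m (M - c%:M)) = \sum_(a <- s) (a - c) ^+ 2.
Proof.
move=> Msym Mchar; have [U [d [/unitarymx_unit Uu ds ME]]] := symmetric_spectral Msym Mchar.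
(* [diagonalizes_shift] treats c - M, not M - c; the square hides the sign. *)
rewrite -opprB mulNmx mulmxN opprK.
under eq_bigr => a _ do rewrite -sqrrN opprB expr2.
have cM := diagonalizes_shift Uu c ME.
exact: (diagonalizes_trace Uu ds (g := fun a => (c - a) * (c - a))
  (diagonalizes_mul Uu cM cM)).
Qed.

Lemma symmetric_trace_resolvent (R : rcfType) n (M Z : 'M[R]_n) (s : seq R) :
  M^T = M -> char_poly M = \prod_(a <- s) ('X - a%:P) -> 1 \notin s ->
  (1%:M - M) *m Z = 1%:M ->
  \tr Z = \sum_(a <- s) (1 - a)^-1.
Proof.
move=> Msym Mchar s1 Zinv.
have [U [d [/unitarymx_unit Uu ds ME]]] := symmetric_spectral Msym Mchar.
have d1 i : 1 - d i != 0.
  rewrite subr_eq0 eq_sym; apply: contraNneq s1 => <-.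
  by rewrite -(perm_mem ds) map_f ?mem_index_enum.
apply: (diagonalizes_trace Uu ds (g := fun a => (1 - a)^-1)).
exact: (diagonalizes_inv (d1 := fun i => 1 - d i) Uu d1 Zinv (diagonalizes_shift Uu 1 ME)).
Qed.

(** In the unitary coordinates [y] of [x], both sides are weighted sums of the |y_i|^2, with weights
    [c] and the eigenvalues respectively. *)
Lemma rayleigh_ge (R : rcfType) n (M : 'M[R]_n) (s : seq R) (c : R) (x : 'rV[R]_n) :
  M^T = M -> char_poly M = \prod_(a <- s) ('X - a%:P) ->
  {in s, forall a, c <= a} ->
  c * (x *m x^T) 0 0 <= (x *m M *m x^T) 0 0.
Proof.
move=> Msym Mchar sc; have [U [d [Uu ds ME]]] := symmetric_spectral Msym Mchar.
pose X := map_mx (real_complex R) x; pose y := X *m invmx U.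
have {}Uu := Uu; have Uunit := unitarymx_unit Uu.
(* As [x] is real and [U] unitary, U x^T is the conjugate transpose of [y]. *)
have XE : map_mx (real_complex R) x^T = invmx U *m map_mx Num.conj y^T.
  apply: (canRL (mulKmx Uunit)); rewrite /y invmx_unitary // trmx_mul map_mxM.
  have -> : map_mx Num.conj (map_mx Num.conj U^T)^T = U by rewrite trmxCK.
  congr (U *m _); apply/matrixP => i k; rewrite !mxE.
  exact/esym/conjc_real.
have xxE : real_complex R ((x *m x^T) 0 0) = \sum_i `|y 0 i| ^+ 2.
  transitivity ((map_mx (real_complex R) (x *m x^T)) 0 0); first by rewrite [RHS]mxE.
  rewrite map_mxM XE mulmxA -/y.
  by rewrite mxE; apply: eq_bigr => i _; rewrite !mxE normCK.
have xMxE : real_complex R ((x *m M *m x^T) 0 0) =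
    \sum_i real_complex R (d i) * `|y 0 i| ^+ 2.
  transitivity ((map_mx (real_complex R) (x *m M *m x^T)) 0 0); first by rewrite [RHS]mxE.
  rewrite !map_mxM XE ME -/X !mulmxA -/y mulmxK // mxE.
  apply: eq_bigr => i _; rewrite mul_mx_diag !mxE normCK.
  by rewrite mulrCA mulrA.
rewrite -lecR rmorphM /= xxE xMxE mulr_sumr; apply: ler_sum => i _.
rewrite ler_wpM2r ?exprn_ge0 // lecR sc // -(perm_mem ds) map_f //.
exact: mem_index_enum.
Qed.

(** * Deflation of an eigenvalue 1 *)

(** The block matrix [1, -w; u, a] becomes block triangular after multiplication by [1, w; 0, 1] on
    the right, and also by [a, w; 0, 1] on the left. Keeping the factor [a] on both sides avoids
    inverting it; in the application it is a polynomial. *)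
Lemma det_scalar_add_rank1 (R : comNzRingType) n (a : R) (u : 'cV[R]_n) (w : 'rV[R]_n) :
  a * \det (a%:M + u *m w) = (a + (w *m u) 0 0) * a ^+ n.
Proof.
pose B := block_mx (1%:M : 'M_1) (- w) u a%:M.
have -> : \det (a%:M + u *m w) = \det B.
  rewrite -[RHS]mulr1 -[X in _ * X](_ : \det (block_mx (1%:M : 'M_1) w 0 1%:M) = 1).
    rewrite -det_mulmx mulmx_block !mulmx1 !mul1mx !mulmx0 !addr0 subrr.
    by rewrite det_lblock det1 mul1r addrC.
  by rewrite det_ublock !det1 mulr1.
rewrite -[X in X * \det B](_ : \det (block_mx (a%:M : 'M_1) w 0 1%:M) = a).
  rewrite -det_mulmx mulmx_block !mul1mx !mul0mx !add0r mulmx1.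
  rewrite mul_scalar_mx mul_mx_scalar scalerN addNr det_lblock det_scalar.
  by rewrite det_mx11 !mxE eqxx.
by rewrite det_ublock det1 mulr1 det_scalar1.
Qed.

(* ('X - N) ('X - 1 + v^T v) = ('X - 1) ('X - N + v^T v), as N fixes v^T; take
   determinants. *)
Lemma char_poly_deflation (R : idomainType) n (N : 'M[R]_n) (v : 'rV[R]_n) :
  N *m v^T = v^T -> v *m v^T = 1%:M ->
  char_poly (N - v^T *m v) * ('X - 1%:P) = char_poly N * 'X.
Proof.
move=> Nv vv.
pose V := map_mx polyC v; pose y : {poly R} := 'X - 1%:P.
have VV : V *m V^T = 1%:M by rewrite /V map_trmx -map_mxM vv map_mx1.
have NV : map_mx polyC N *m V^T = V^T by rewrite /V map_trmx -map_mxM Nv.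
have prodE : char_poly_mx N *m (y%:M + V^T *m V) = y%:M *m char_poly_mx (N - v^T *m v).
  have cV : char_poly_mx N *m V^T = y *: V^T.
    by rewrite mulmxBl NV mul_scalar_mx scalerBl scale1r.
  rewrite mulmxDr mulmxA cV -scalemxAl mul_mx_scalar mul_scalar_mx -scalerDr.
  by rewrite /char_poly_mx map_mxB map_mxM -map_trmx -/V opprB addrCA addrC.
have y0 : y != 0 by rewrite polyXsubC_eq0.
(* [y ^+ n] is the determinant of [y%:M]; the rank-one determinant times [y] is ['X * y ^+ n], since
   y + 1 = 'X. *)
apply: (mulfI (expf_neq0 n y0)).
have detE := congr1 determinant prodE; rewrite !det_mulmx det_scalar in detE.
rewrite mulrA -[X in X * y]detE -mulrA [_ * y]mulrC det_scalar_add_rank1 VV mxE.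
by rewrite /y subrK mulrA mulrC.
Qed.

Lemma char_poly_deflation_roots (R : idomainType) n (N : 'M[R]_n) (v : 'rV[R]_n) (s : seq R) :
  N *m v^T = v^T -> v *m v^T = 1%:M ->
  char_poly N = \prod_(a <- 1 :: s) ('X - a%:P) ->
  char_poly (N - v^T *m v) = \prod_(a <- 0 :: s) ('X - a%:P).
Proof.
move=> Nv vv NE.
have y0 : 'X - 1%:P != 0 :> {poly R} by rewrite polyXsubC_eq0.
apply: (mulIf y0); rewrite char_poly_deflation // NE !big_cons subr0.
by rewrite mulrC mulrCA [LHS]mulrC.
Qed.

(** * Rank two rigidity *)

(** For symmetric [W] the trace of W^2 is the sum of the squared entries. *)
Lemma symmetric_trace_sqr_eq0 (R : realDomainType) n (W : 'M[R]_n) :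
  W^T = W -> \tr (W *m W) <= 0 -> W = 0.
Proof.
move=> Wsym trW; apply/matrixP => l m; rewrite mxE; apply/eqP; rewrite -sqrf_eq0.
have trE : \tr (W *m W) = \sum_i \sum_k W i k ^+ 2.
  apply: eq_bigr => i _; rewrite mxE; apply: eq_bigr => k _.
  by rewrite -{2}Wsym mxE expr2.
have nn i : 0 <= \sum_k W i k ^+ 2 by apply: sumr_ge0 => k _; exact: sqr_ge0.
have : \sum_i \sum_k W i k ^+ 2 == 0.
  by rewrite eq_le -trE trW /= trE sumr_ge0.
rewrite psumr_eq0 => [/allP/(_ l (mem_index_enum _))/=|//].
rewrite psumr_eq0 => [/allP/(_ m (mem_index_enum _))//|k _]; exact: sqr_ge0.
Qed.

Lemma trace_mul_rank1 (R : comNzRingType) n (A : 'M[R]_n) (x : 'rV[R]_n) :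
  \tr (A *m (x^T *m x)) = (x *m A *m x^T) 0 0.
Proof. by rewrite mulmxA mxtrace_mulC mulmxA /mxtrace big_ord1. Qed.

(** The Frobenius norm of [A] leaves no room beyond the values [a] along [v] and [b] along [x]. The
    opposite signs of [a] and [b] take the place of orthogonality of [v] and [x]. *)
Lemma rank2_rigidity (R : realFieldType) n (A : 'M[R]_n) (v x : 'rV[R]_n) (a b : R) :
  A^T = A -> \tr (A *m A) = a ^+ 2 + b ^+ 2 -> 0 <= a -> b <= 0 ->
  v *m v^T = 1%:M -> x *m x^T = 1%:M ->
  (v *m A *m v^T) 0 0 = a -> (x *m A *m x^T) 0 0 = b ->
  A = a *: (v^T *m v) + b *: (x^T *m x).
Proof.
move=> Asym trA a0 b0 vv xx vAv xAx; apply/eqP; rewrite -subr_eq0; apply/eqP.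
(* The trace of W ^ 2 reduces to the cross term [2 a b (x v^T) ^ 2 <= 0]. *)
set W := _ - _; apply: symmetric_trace_sqr_eq0.
  by rewrite /W raddfB raddfD /= !linearZ /= Asym !trmx_mul !trmxK.
pose V := v^T *m v; pose X := x^T *m x.
have WE B : \tr (W *m B) = \tr (A *m B) - a * \tr (V *m B) - b * \tr (X *m B).
  by rewrite /W mulmxBl mulmxDl -!scalemxAl raddfB raddfD /= !mxtraceZ opprD addrA.
have trV : \tr (V *m V) = 1 by rewrite trace_mul_rank1 /V mulmxA vv mul1mx vv mxE.
have trX : \tr (X *m X) = 1 by rewrite trace_mul_rank1 /X mulmxA xx mul1mx xx mxE.
have trXV : \tr (V *m X) = ((x *m v^T) 0 0) ^+ 2.
  rewrite trace_mul_rank1 /V mulmxA -mulmxA mxE big_ord1 expr2; congr (_ * _).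
  by rewrite !mxE; apply: eq_bigr => k _; rewrite !mxE mulrC.
have trWV : \tr (W *m V) = - b * ((x *m v^T) 0 0) ^+ 2.
  by rewrite WE trV (mxtrace_mulC X) trXV trace_mul_rank1 vAv; ring.
have trWX : \tr (W *m X) = - a * ((x *m v^T) 0 0) ^+ 2.
  by rewrite WE trX trXV trace_mul_rank1 xAx; ring.
rewrite {2}/W mulmxBr mulmxDr -!scalemxAr raddfB raddfD /= !mxtraceZ -/V -/X trWV trWX.
rewrite WE trA (mxtrace_mulC V) (mxtrace_mulC X) !trace_mul_rank1 vAv xAx.
have -> : a ^+ 2 + b ^+ 2 - a * a - b * b - (a * (- b * (x *m v^T) 0 0 ^+ 2) +
  b * (- a * (x *m v^T) 0 0 ^+ 2)) = 2 * ((a * b) * (x *m v^T) 0 0 ^+ 2) by ring.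
by rewrite pmulr_rle0 // mulr_le0_ge0 ?sqr_ge0 // mulr_ge0_le0.
Qed.

(** * Mean first passage times *)

Lemma big_tupleS (R : nmodType) (T : finType) t (F : t.+1.-tuple T -> R)
    (A : pred (t.+1.-tuple T)) :
  \sum_(w | A w) F w =
  \sum_(x : T) \sum_(w : t.-tuple T | A [tuple of x :: w]) F [tuple of x :: w].
Proof.
rewrite pair_big_dep /=.
rewrite (reindex (fun p : T * t.-tuple T => [tuple of p.1 :: p.2])) //.
exists (fun w => (thead w, [tuple of behead w])) => [[x w] _|w _] /=.
  by congr pair; apply: val_inj.
by rewrite -tuple_eta.
Qed.

(** Condition on the first step [k]; if it hits [i], the passage is over and no further step is
    allowed. *)
Lemma first_passage_probS (R : realType) n (P : 'M[R]_n) j i t :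
  first_passage_prob P j i t.+1 =
  \sum_k P j k * (if k == i then (t == 0)%:R else first_passage_prob P k i t).
Proof.
rewrite /first_passage_prob big_tupleS; apply: eq_bigr => k _ /=.
rewrite -big_distrr /=; congr (_ * _); case: eqVneq => [->|ki].
  rewrite eqSS eq_sym; case: eqVneq => [->|t0]; last by rewrite big_pred0.
  by rewrite (big_pred1 [tuple]) // => w; rewrite [w]tuple0; apply/esym/eqP.
by apply: eq_bigl => w; rewrite eqSS.
Qed.

Lemma first_passage_prob0 (R : realType) n (P : 'M[R]_n) j i :
  first_passage_prob P j i 0 = 0.
Proof. by rewrite /first_passage_prob big_pred0. Qed.

(* One step of the chain killed at i: the t-th iterate on the constant 1 is
   x |-> P_x(T_i > t). *)
Definition avoid_step (R : realType) n (P : 'M[R]_n) (i : 'I_n) (u : 'I_n -> R) :=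
  fun j => \sum_(k | k != i) P j k * u k.

(** T_i = t + 1 is the difference of the events T_i > t and T_i > t + 1; this form allows summation
    by parts. *)
Lemma first_passage_prob_survival (R : realType) n (P : 'M[R]_n) j i t :
  (forall x, \sum_y P x y = 1) ->
  first_passage_prob P j i t.+1 =
    iter t (avoid_step P i) (fun=> 1) j - iter t.+1 (avoid_step P i) (fun=> 1) j.
Proof.
move=> P1; elim: t j => [|t IHt] j; rewrite first_passage_probS (bigD1 i) //= eqxx.
  rewrite big1 => [|k /negbTE->]; last by rewrite first_passage_prob0 mulr0.
  have -> : avoid_step P i (fun=> 1) j = \sum_(k | k != i) P j k.
    by apply: eq_bigr => k _; rewrite mulr1.
  by rewrite addr0 mulr1 -[X in X - _](P1 j) (bigD1 i) //= addrK.
rewrite mulr0 add0r /avoid_step -sumrB; apply: eq_bigr => k ki.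
by rewrite (negbTE ki) IHt mulrBr.
Qed.

Lemma avoid_step_le (R : realType) n (P : 'M[R]_n) i (u v : 'I_n -> R) :
  (forall x y, 0 <= P x y) -> (forall x, u x <= v x) ->
  forall x, avoid_step P i u x <= avoid_step P i v x.
Proof. by move=> P0 uv x; apply: ler_sum => k _; rewrite ler_wpM2l. Qed.

(** With r = q^2, one factor q^t absorbs the linear growth while the other still tends to 0. *)
Lemma cvg_natM_expr (R : realType) (r : R) : 0 <= r -> r < 1 ->
  ((fun t => t.+1%:R * r ^+ t) @ \oo --> (0 : R))%classic.
Proof.
move=> r0 r1; pose q := Num.sqrt r.
have q0 : 0 <= q by exact: sqrtr_ge0.
have q1 : q < 1 by rewrite -sqrtr1 ltr_sqrt.
(* Each of the t + 1 terms of the geometric sum is at least [q ^ t]. *)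
have nq t : t.+1%:R * q ^+ t <= (1 - q)^-1.
  rewrite -[leRHS]mul1r ler_pdivlMr ?subr_gt0 // mulrC.
  apply: (@le_trans _ _ ((1 - q) * \sum_(k < t.+1) q ^+ k)).
    rewrite ler_wpM2l ?subr_ge0 ?(ltW q1) //.
    have -> : t.+1%:R * q ^+ t = \sum_(k < t.+1) q ^+ t.
      by rewrite sumr_const card_ord mulr_natl.
    by apply: ler_sum => k _; rewrite ler_wiXn2l ?(ltW q1) // -ltnS.
  by rewrite -opprB mulNr -subrX1 opprB gerBl exprn_ge0.
apply: (@squeeze_cvgr _ _ _ R (fun=> 0) (geometric (1 - q)^-1 q)); last first.
- by apply: cvg_geometric; rewrite ger0_norm.
- exact: cvg_cst.
apply: nearW => t; rewrite mulr_ge0 ?exprn_ge0 //= -(sqr_sqrtr r0) -/q -exprM mulnC.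
by rewrite muln2 -addnn exprD mulrA ler_wpM2r ?exprn_ge0.
Qed.

(** * Solutions of the first-step equation are mean first passage times *)

Section HittingTime.
Variables (R : realType) (n : nat) (P : 'M[R]_n) (i : 'I_n) (h : 'I_n -> R).
Hypothesis P0 : forall x y, 0 <= P x y.
Hypothesis P1 : forall x, \sum_y P x y = 1.
Hypothesis hE : forall x, h x = 1 + avoid_step P i h x.

Local Notation Q := (avoid_step P i).
Local Notation g := (fun t => iter t Q (fun=> 1)).

(** Minimum principle: at a minimizer [y] with h y < 0, the row of the killed chain has mass at most
    1, so (Q h) y >= h y and h y >= 1 + h y. *)
Lemma hitting_solution_ge0 x : 0 <= h x.
Proof.
have [y _ ymin] := arg_minP h (isT : xpredT x).
apply: le_trans (ymin x isT); rewrite leNgt; apply/negP => hy.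
have : h y >= 1 + h y.
  rewrite {2}hE lerD2l; apply: (@le_trans _ _ (\sum_(k | k != i) P y k * h y)).
    rewrite -mulr_suml -[leLHS]mul1r ler_wnM2r ?(ltW hy) // -(P1 y).
    by rewrite [leRHS](bigD1 i) //= lerDr.
  by apply: ler_sum => k _; rewrite ler_wpM2l // ymin.
by rewrite gerDr ler10.
Qed.

Lemma hitting_solution_ge1 x : 1 <= h x.
Proof.
rewrite hE lerDl sumr_ge0 // => k _.
by rewrite mulr_ge0 // hitting_solution_ge0.
Qed.

(** This is Q^t applied to h = 1 + Q h. *)
Lemma iter_avoid_stepD t x : iter t Q h x = g t x + iter t.+1 Q h x.
Proof.
elim: t x => [|t IHt] x; first by rewrite /= -hE.
rewrite !iterS /avoid_step -big_split /=; apply: eq_bigr => k _.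
by rewrite -mulrDr IHt.
Qed.

Lemma hitting_solution_partial T x :
  h x = \sum_(t < T) g t x + iter T Q h x.
Proof.
elim: T => [|T IHT]; first by rewrite big_ord0 add0r.
by rewrite big_ord_recr -addrA /= -iter_avoid_stepD.
Qed.

(** Summation by parts turns the left side into the sum of the survival probabilities for t < T,
    minus the boundary term T g_T. *)
Lemma mean_first_passage_partial T x :
  \sum_(0 <= t < T.+1) t%:R * first_passage_prob P x i t =
  h x - iter T Q h x - T%:R * g T x.
Proof.
rewrite {1}(hitting_solution_partial T) addrK big_nat_recl // mul0r add0r.
elim: T => [|T IHT]; first by rewrite big_nil big_ord0 mul0r subr0.
rewrite big_nat_recr //= IHT big_ord_recr /= first_passage_prob_survival //=.
by rewrite -natr1; ring.
Qed.

(** [Q] is monotone and 1 <= h. The boundary term T g_T thus inherits the geometric decay of Q^T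
    h. *)
Lemma survival_le T x : g T x <= iter T Q h x.
Proof.
elim: T x => [|T IHT] x; first exact: hitting_solution_ge1.
exact: avoid_step_le.
Qed.

(* As 1 <= h <= H, the first-step equation gives Q h = h - 1 <= (1 - H^-1) h. *)
Lemma iter_avoid_step_le T x (H : R) : (forall y, h y <= H) ->
  iter T Q h x <= (1 - H^-1) ^+ T * h x.
Proof.
move=> hH; have H1 : 1 <= H := le_trans (hitting_solution_ge1 x) (hH x).
have H0 : 0 < H by exact: lt_le_trans H1.
have r0 : 0 <= 1 - H^-1 by rewrite subr_ge0 invf_le1.
elim: T x => [|T IHT] x; first by rewrite mul1r.
apply: le_trans (avoid_step_le i P0 IHT x) _.
rewrite /avoid_step; under eq_bigr do rewrite mulrCA.
rewrite -mulr_sumr exprSr -mulrA ler_wpM2l ?exprn_ge0 //.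
rewrite mulrBl mul1r [X in _ <= X - _]hE addrAC lerDr subr_ge0 mulrC.
by rewrite ler_pdivrMr ?mul1r.
Qed.

Lemma survival_ge0 T x : 0 <= g T x.
Proof.
elim: T x => [|T IHT] x //=; apply: sumr_ge0 => k _.
by rewrite mulr_ge0.
Qed.

Lemma mean_first_passageE x : mean_first_passage P x i = (h x)%:E.
Proof.
(* The sum serves as an upper bound of [h], since [h] is nonnegative. *)
pose H := \sum_y h y.
have hH y : h y <= H.
  by rewrite /H (bigD1 y) //= lerDl sumr_ge0 // => k _; exact: hitting_solution_ge0.
have H1 : 1 <= H := le_trans (hitting_solution_ge1 x) (hH x).
have H0 : 0 < H by exact: lt_le_trans H1.
have r0 : 0 <= 1 - H^-1 by rewrite subr_ge0 invf_le1.
have r1 : 1 - H^-1 < 1 by rewrite ltrBlDr ltrDl invr_gt0.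
(* The two error terms add up to at most (T + 1) Q^T h, which is at most h x times (T + 1) (1 -
   1/H)^T. *)
have err : ((fun T => iter T Q h x + T%:R * g T x) @ \oo --> (0 : R))%classic.
  apply: (@squeeze_cvgr _ _ _ R (fun=> 0) (fun T => h x * (T.+1%:R * (1 - H^-1) ^+ T))).
  - apply: nearW => T; have g0 : 0 <= g T x := survival_ge0 T x.
    rewrite addr_ge0 ?mulr_ge0 ?(le_trans g0 (survival_le T x)) //=.
    apply: (@le_trans _ _ (T.+1%:R * iter T Q h x)).
      by rewrite -natr1 mulrDl mul1r addrC lerD2r ler_wpM2l // survival_le.
    by rewrite [leRHS]mulrCA ler_wpM2l // mulrC iter_avoid_step_le.
  - exact: cvg_cst.
  - rewrite -(mulr0 (h x)); apply: cvgMr; exact: cvg_natM_expr.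
apply/cvg_lim => //; rewrite -cvg_shiftS.
have -> : (fun T => (\sum_(0 <= t < T.+1) (t%:R * first_passage_prob P x i t)%:E)%E) =
          EFin \o (fun T => h x - (iter T Q h x + T%:R * g T x)).
  by apply/funext => T /=; rewrite sumEFin mean_first_passage_partial opprD addrA.
apply: cvg_EFin; first by near=> T.
have := cvgB (cvg_cst (h x)) err; rewrite subr0; exact.
Unshelve. all: by end_near.
Qed.

End HittingTime.

Lemma mulmx_const1 (R : pzRingType) m n (A : 'M[R]_(m, n)) :
  (forall i, \sum_k A i k = 1) -> A *m const_mx 1 = const_mx 1 :> 'cV_m.
Proof.
move=> A1; apply/colP => i; rewrite !mxE -[RHS](A1 i).
by apply: eq_bigr => k _; rewrite mxE mulr1.
Qed.

(** It suffices that the closed form solves the first-step equation; this follows from p Z = p and P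
    Z = Z - 1 + 1 p. *)
Lemma mean_first_passage_fundamental (R : realType) n (P Z : 'M[R]_n) (p : 'rV[R]_n) x i :
  (forall x y, 0 <= P x y) -> (forall x, \sum_y P x y = 1) ->
  stationary_distribution P p -> (forall i, p 0 i != 0) ->
  (1%:M - P + const_mx 1 *m p) *m Z = 1%:M ->
  mean_first_passage P x i = (((x == i)%:R - Z x i + Z i i) / p 0 i)%:E.
Proof.
move=> P0 P1 [_ p1 pP] pN0 ZE.
have pZ : p *m Z = p.
  rewrite -[RHS]mulmx1 -ZE mulmxA mulmxDr mulmxBr mulmx1 pP subrr add0r mulmxA.
  rewrite mulmx_const1 => [|i0]; last by rewrite ord1.
  by rewrite [const_mx 1]mx11_scalar mxE mul1mx.
have PZ y k : \sum_z P y z * Z z k = Z y k - (y == k)%:R + p 0 k.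
  move: ZE; rewrite mulmxDl mulmxBl mul1mx -mulmxA pZ => /matrixP/(_ y k).
  by rewrite !mxE big_ord1 !mxE mul1r => <-; ring.
apply: (mean_first_passageE (h := fun y => ((y == i)%:R - Z y i + Z i i) / p 0 i)) => // y.
have -> : avoid_step P i (fun y => ((y == i)%:R - Z y i + Z i i) / p 0 i) y =
    (- (\sum_z P y z * Z z i) + Z i i) / p 0 i.
  have -> : - (\sum_z P y z * Z z i) + Z i i = \sum_z P y z * (- Z z i + Z i i).
    under [RHS]eq_bigr do rewrite mulrDr mulrN.
    by rewrite big_split /= -mulr_suml P1 mul1r sumrN.
  (* At z = i the summand - Z i i + Z i i vanishes, so the sum over all states equals the sum
     avoiding [i]. *)
  rewrite [in RHS](bigD1 i) //= addNr mulr0 add0r mulr_suml.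
  by apply: eq_bigr => z /negbTE->; rewrite sub0r mulrA.
by rewrite PZ; field; exact: pN0.
Qed.

(** The weights p_i cancel the denominators. As the rows of [Z] sum to 1, the terms [j = i] - Z_ji
    cancel in total and only the trace remains, whatever [j] is. *)
Lemma kemeny_fundamental (R : realType) n (P Z : 'M[R]_n) (p : 'rV[R]_n) j :
  (forall x y, 0 <= P x y) -> (forall x, \sum_y P x y = 1) ->
  stationary_distribution P p -> (forall i, p 0 i != 0) ->
  (1%:M - P + const_mx 1 *m p) *m Z = 1%:M ->
  (\sum_i (p 0 i)%:E * mean_first_passage P j i - 1)%E = (\tr Z - 1)%:E.
Proof.
move=> P0 P1 pst pN0 ZE.
under eq_bigr => i _.
  rewrite (mean_first_passage_fundamental _ _ P0 P1 pst pN0 ZE) -EFinM mulrC divfK //.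
  over.
have Z1 : \sum_i Z j i = 1.
  have : Z *m const_mx 1 = const_mx 1 :> 'cV_n.
    have [Bu _] := mulmx1_unit ZE; apply: (can_inj (mulKmx Bu)).
    case: pst => _ p1 _.
    rewrite mulmxA ZE mul1mx mulmxDl mulmxBl mul1mx -mulmxA.
    rewrite mulmx_const1 // subrr add0r mulmx_const1 => [|i0]; last by rewrite ord1.
    by rewrite [X in _ *m X]mx11_scalar mxE mulmx1.
  move/colP/(_ j); rewrite !mxE => <-.
  by apply: eq_bigr => z _; rewrite mxE mulr1.
rewrite sumEFin -EFinB big_split /= sumrB Z1 (bigD1 j) //= eqxx big1 => [|k /negbTE].
  by rewrite addr0 subrr add0r.
by rewrite eq_sym => ->.
Qed.

(** * The normalized adjacency matrix of a connected graph *)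

Section Graph.
Variables (R : realType) (n : nat) (e : rel 'I_n).
Hypothesis n_ge2 : (2 <= n)%N.
Hypothesis e_sym : symmetric e.
Hypothesis e_irr : irreflexive e.
Hypothesis e_conn : connected_graph e.

Local Notation deg i := ((degree e i)%:R : R).
Local Notation sdeg i := (Num.sqrt (deg i)).
Local Notation N := (normalized_adj_mx R e).
Local Notation P := (transition_mx R e).

Lemma degree_gt0 i : (0 < degree e i)%N.
Proof.
have [y yi] : exists y : 'I_n, y != i.
  case: n n_ge2 i => [//|[//|m]] _ i.
  by have [->|i0] := eqVneq i 0; [exists ord_max | exists 0; rewrite eq_sym].
have /connectP[[|z w] /= pw yE] := e_conn i y; first by rewrite yE eqxx in yi.
by apply/card_gt0P; exists z; rewrite inE; case/andP: pw.
Qed.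

Lemma degree_sum i : deg i = \sum_k (e i k)%:R.
Proof.
rewrite /degree -sum1_card natr_sum big_mkcond /=.
by apply: eq_bigr => k _; rewrite inE; case: (e i k).
Qed.

Lemma connected_constant (T : Type) (y : 'I_n -> T) :
  (forall i k, e i k -> y i = y k) -> forall i k, y i = y k.
Proof.
move=> ye i k; have /connectP[w pw ->] := e_conn i k.
by elim: w i pw => //= z w IHw i /andP[/ye-> /IHw].
Qed.

(** Expanding the square, each pure term gives the degree-weighted norm of [y] by symmetry, and the
    mixed term gives [a] times that norm. *)
Lemma dirichlet_form (a : R) (y : 'I_n -> R) :
  (forall k, a * deg k * y k = \sum_i (e i k)%:R * y i) ->
  \sum_i \sum_k (e i k)%:R * (y i - y k) ^+ 2 =
  2 * (1 - a) * \sum_k deg k * y k ^+ 2.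
Proof.
move=> yE.
have degs : \sum_k deg k * y k ^+ 2 = \sum_i \sum_k (e i k)%:R * y i ^+ 2.
  by apply: eq_bigr => i _; rewrite degree_sum mulr_suml.
have degs' : \sum_k deg k * y k ^+ 2 = \sum_i \sum_k (e i k)%:R * y k ^+ 2.
  rewrite degs exchange_big /=; apply: eq_bigr => i _; apply: eq_bigr => k _.
  by rewrite e_sym.
have cross : a * \sum_k deg k * y k ^+ 2 = \sum_i \sum_k (e i k)%:R * (y i * y k).
  rewrite exchange_big mulr_sumr /=; apply: eq_bigr => k _.
  by rewrite expr2 !mulrA yE mulr_suml; apply: eq_bigr => i _; rewrite mulrA.
have -> : 2 * (1 - a) * \sum_k deg k * y k ^+ 2 = \sum_k deg k * y k ^+ 2 +
  \sum_k deg k * y k ^+ 2 - 2 * (a * \sum_k deg k * y k ^+ 2) by ring.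
rewrite cross {1}degs degs' mulr_sumr -big_split -sumrB; apply: eq_bigr => i _ /=.
rewrite mulr_sumr -big_split -sumrB; apply: eq_bigr => k _ /=; ring.
Qed.

Lemma dirichlet_le1 (a : R) (y : 'I_n -> R) (i0 : 'I_n) :
  (forall k, a * deg k * y k = \sum_i (e i k)%:R * y i) -> y i0 != 0 -> a <= 1.
Proof.
move=> yE y0.
have S0 : 0 < \sum_k deg k * y k ^+ 2.
  rewrite (bigD1 i0) //= ltr_pwDl //.
    by rewrite mulr_gt0 ?ltr0n ?degree_gt0 // exprn_even_gt0.
  by apply: sumr_ge0 => k _; rewrite mulr_ge0 // sqr_ge0.
rewrite -subr_ge0 -(pmulr_rge0 _ (ltr0n R 2)) -(pmulr_lge0 _ S0) -dirichlet_form //.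
by apply: sumr_ge0 => i _; apply: sumr_ge0 => k _; rewrite mulr_ge0 // sqr_ge0.
Qed.

(** For a = 1 the Dirichlet form vanishes, so [y] agrees across every edge; connectedness does the
    rest. *)
Lemma harmonic_constant (y : 'I_n -> R) :
  (forall k, deg k * y k = \sum_i (e i k)%:R * y i) -> forall i k, y i = y k.
Proof.
move=> yE; apply: connected_constant => i k eik.
have : \sum_i \sum_k (e i k)%:R * (y i - y k) ^+ 2 == 0.
  rewrite (dirichlet_form (a := 1)) ?subrr ?mulr0 ?mul0r // => m.
  by rewrite mul1r.
have nn (i' k' : 'I_n) : 0 <= (e i' k')%:R * (y i' - y k') ^+ 2 by rewrite mulr_ge0 // sqr_ge0.
rewrite psumr_eq0 => [/allP/(_ i (mem_index_enum _))/=|i' _]; last by apply: sumr_ge0.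
rewrite psumr_eq0 // => /allP/(_ k (mem_index_enum _))/=.
by rewrite eik mul1r sqrf_eq0 subr_eq0 => /eqP.
Qed.

Lemma deg_gt0 i : 0 < deg i.
Proof. by rewrite ltr0n degree_gt0. Qed.

Lemma sdeg_gt0 i : 0 < sdeg i.
Proof. by rewrite sqrtr_gt0 deg_gt0. Qed.

Lemma sdeg_neq0 i : sdeg i != 0.
Proof. by rewrite gt_eqF ?sdeg_gt0. Qed.

Lemma sdeg_sqr i : sdeg i ^+ 2 = deg i.
Proof. by rewrite sqr_sqrtr ?ltW ?deg_gt0. Qed.

Definition volume : R := \sum_i deg i.

Lemma volume_gt0 : 0 < volume.
Proof.
have i0 : 'I_n by case: n n_ge2 => [|m _] //; exact: ord0.
rewrite /volume (bigD1 i0) //= ltr_pwDl ?deg_gt0 //.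
by apply: sumr_ge0.
Qed.

Definition perron_row : 'rV[R]_n := \row_i (sdeg i / Num.sqrt volume).
Local Notation v := perron_row.

Lemma normalized_adjE i k : N i k = (e i k)%:R / (sdeg i * sdeg k).
Proof.
rewrite /normalized_adj_mx /inv_sqrt_degree_mx mul_mx_diag mul_diag_mx !mxE.
by rewrite invfM mulrA [X in X * _ = _]mulrC.
Qed.

Lemma normalized_adj_sym : N^T = N.
Proof.
by apply/matrixP => i k; rewrite mxE !normalized_adjE e_sym [sdeg k * _]mulrC.
Qed.

Lemma transitionE i k : P i k = (e i k)%:R / deg i.
Proof.
pose Q : 'M[R]_n := \matrix_(i, k) ((e i k)%:R / deg i).
have degu : degree_mx R e \in unitmx.
  rewrite unitmxE det_diag unitfE; apply/prodf_neq0 => m _.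
  by rewrite mxE gt_eqF ?deg_gt0.
have AE : adj_mx R e = degree_mx R e *m Q.
  apply/matrixP => a b; rewrite mul_diag_mx !mxE mulrC divfK //.
  by rewrite gt_eqF ?deg_gt0.
by rewrite /transition_mx AE mulKmx // mxE.
Qed.

Lemma transition_ge0 i k : 0 <= P i k.
Proof. by rewrite transitionE divr_ge0. Qed.

Lemma transition_row_sum i : \sum_k P i k = 1.
Proof.
under eq_bigr do rewrite transitionE.
by rewrite -mulr_suml -degree_sum // divff // gt_eqF ?deg_gt0.
Qed.

Lemma stationaryE p i : stationary_distribution P p -> p 0 i = deg i / volume.
Proof.
case=> _ p1 pP.
(* Stationarity says that p_i / deg i is harmonic; its constant value is then fixed by
   normalization. *)
have yc : forall i k, p 0 i / deg i = p 0 k / deg k.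
  apply: harmonic_constant => k; rewrite mulrC divfK ?gt_eqF ?deg_gt0 // -{1}pP mxE.
  by apply: eq_bigr => m _; rewrite transitionE mulrA mulrAC mulrC.
have pE k : p 0 k = deg k * (p 0 i / deg i).
  by rewrite (yc i k) mulrC divfK ?gt_eqF ?deg_gt0.
have := p1; under eq_bigr do rewrite pE.
rewrite -mulr_suml -/volume => cE.
rewrite pE; congr (_ * _); apply: (mulfI (lt0r_neq0 volume_gt0)).
by rewrite cE divff // lt0r_neq0 // volume_gt0.
Qed.

Lemma perron_row_norm : v *m v^T = 1%:M.
Proof.
apply/matrixP => i k; rewrite !ord1 mxE [RHS]mxE /=.
have -> : \sum_m v 0 m * v^T m 0 = \sum_m deg m / volume.
  apply: eq_bigr => m _; rewrite !mxE mulf_div -!expr2 sdeg_sqr sqr_sqrtr //.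
  exact: ltW volume_gt0.
by rewrite -mulr_suml divff // lt0r_neq0 // volume_gt0.
Qed.

Lemma perron_row_eigen : N *m v^T = v^T.
Proof.
apply/colP => i; rewrite !mxE.
transitivity (\sum_m (e i m)%:R / (sdeg i * Num.sqrt volume)).
  apply: eq_bigr => m _; rewrite normalized_adjE !mxE.
  by rewrite !invfM; field; rewrite !sdeg_neq0 /= lt0r_neq0 // sqrtr_gt0 volume_gt0.
rewrite -mulr_suml -degree_sum // -[X in X / _]sdeg_sqr; field.
by rewrite sdeg_neq0 /= lt0r_neq0 // sqrtr_gt0 volume_gt0.
Qed.

(** Dividing by the square roots of the degrees brings an eigenvector into the form that the
    Dirichlet lemmas take. *)
Lemma eigen_row_harmonic (a : R) (u : 'rV[R]_n) : u *m N = a *: u ->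
  forall k, a * deg k * (u 0 k / sdeg k) = \sum_i (e i k)%:R * (u 0 i / sdeg i).
Proof.
move=> /rowP uN k; have := uN k; rewrite !mxE => /(congr1 (fun z => z * sdeg k)).
rewrite mulr_suml => H.
have -> : a * deg k * (u 0 k / sdeg k) = a * u 0 k * sdeg k.
  by rewrite -{1}sdeg_sqr; field; exact: sdeg_neq0.
rewrite -H; apply: eq_bigr => i _; rewrite normalized_adjE.
by field; rewrite !sdeg_neq0.
Qed.

(** A kernel vector [u] is orthogonal to [v] (multiply by v^T), hence fixed by [N]. By harmonicity
    it is a multiple of [v], so it is 0. *)
Lemma deflated_unit : 1%:M - (N - v^T *m v) \in unitmx.
Proof.
rewrite -row_free_unit -kermx_eq0; apply/rowV0P => u /sub_kermxP.
rewrite opprB addrA addrAC mulmxDr mulmxBr mulmx1 => uE.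
have uv : u *m v^T = 0.
  have /(congr1 (mulmx^~ v^T)) := uE.
  rewrite /= mul0mx mulmxDl mulmxBl -(mulmxA u N) perron_row_eigen -(mulmxA u) -(mulmxA v^T).
  by rewrite perron_row_norm mulmx1 subrr add0r.
have uN : u *m N = 1 *: u.
  apply/eqP; rewrite eq_sym scale1r -subr_eq0 -[_ - _]addr0.
  by rewrite -[X in _ + X](mul0mx _ v) -uv -mulmxA uE.
have yc : forall i k, u 0 i / sdeg i = u 0 k / sdeg k.
  apply: harmonic_constant => k.
  by rewrite -(eigen_row_harmonic uN) mul1r.
apply/rowP => i; rewrite mxE.
have uE' m : u 0 m = (u 0 i / sdeg i * Num.sqrt volume) * v 0 m.
  rewrite mxE (yc i m); field.
  by rewrite sdeg_neq0 /= lt0r_neq0 // sqrtr_gt0 volume_gt0.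
have : (u *m v^T) 0 0 = 0 by rewrite uv mxE.
rewrite mxE; under eq_bigr => m _ do rewrite uE' -mulrA [v^T _ _]mxE.
rewrite -mulr_sumr.
have -> : \sum_m v 0 m * v 0 m = 1.
  have := congr1 (fun A : 'M_1 => A 0 0) perron_row_norm.
  rewrite /= [RHS]mxE eqxx mulr1n mxE => <-.
  by apply: eq_bigr => m _; rewrite [v^T _ _]mxE.
by rewrite mulr1 => c0; rewrite uE' c0 mul0r.
Qed.

Lemma spectrum_le1 (s : seq R) : char_poly N = \prod_(a <- s) ('X - a%:P) ->
  {in s, forall a, a <= 1}.
Proof.
move=> Nchar a sa.
have /eigenvalueP[u uN u0] : eigenvalue N a.
  by rewrite eigenvalue_root_char Nchar root_prod_XsubC.
have /rV0Pn[i ui] := u0.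
apply: (dirichlet_le1 (eigen_row_harmonic uN) (i0 := i)).
by rewrite mulf_neq0 // invr_eq0 sdeg_neq0.
Qed.

(** [v] makes 1 an eigenvalue and [spectrum_le1] puts it first. A second 1 would survive deflation,
    against [deflated_unit]. *)
Lemma spectrum_head (s : seq R) : ordered_spectrum N s ->
  exists s', [/\ s = 1 :: s', sorted >=%R s', size s' = n.-1 & 1 \notin s'] /\
    char_poly (N - v^T *m v) = \prod_(a <- 0 :: s') ('X - a%:P).
Proof.
case=> s_sorted Nchar; have s1 := spectrum_le1 Nchar.
have : 1 \in s.
  rewrite -root_prod_XsubC -Nchar -eigenvalue_root_char; apply/eigenvalueP.
  exists v.
    by rewrite scale1r -[RHS]trmxK -perron_row_eigen trmx_mul trmxK normalized_adj_sym.
  apply/negP => /eqP v0; have := perron_row_norm; rewrite v0 mul0mx => /matrixP/(_ 0 0).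
  by rewrite !mxE => /eqP; rewrite eq_sym oner_eq0.
case: s s_sorted Nchar s1 => // a s' s_sorted Nchar s1 mem1.
have a1 : a = 1.
  apply/le_anti; rewrite s1 ?mem_head //=.
  move: mem1; rewrite inE => /predU1P[<-//|].
  move: s_sorted; rewrite /= (path_sortedE (rev_trans le_trans)) => /andP[/allP H _].
  exact: H.
rewrite {a}a1 in s_sorted Nchar s1 mem1 *.
have defl := char_poly_deflation_roots perron_row_eigen perron_row_norm Nchar.
exists s'; split=> //; split=> //.
- exact: path_sorted s_sorted.
- by have := size_char_poly N; rewrite Nchar size_prod_XsubC => -[] /= <-.
apply/negP => s'1; have : eigenvalue (N - v^T *m v) 1.
  by rewrite eigenvalue_root_char defl root_prod_XsubC inE s'1 orbT.
case/eigenvalueP => u uE u0; case/negP: u0; apply/eqP.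
apply: (can_inj (mulmxK deflated_unit)); rewrite mul0mx mulmxBr mulmx1 uE.
by rewrite scale1r subrr.
Qed.

Lemma kemeny_spectral (p : 'rV[R]_n) (s : seq R) j :
  stationary_distribution P p -> ordered_spectrum N (1 :: s) ->
  kemeny e p j = (\sum_(a <- s) (1 - a)^-1)%:E.
Proof.
move=> hp /spectrum_head[_ [[[<-] _ _ s1] defl]].
pose B := 1%:M - (N - v^T *m v); pose S : 'M[R]_n := diag_mx (\row_i sdeg i).
have Su : S \in unitmx.
  rewrite unitmxE det_diag unitfE; apply/prodf_neq0 => m _.
  by rewrite mxE sdeg_neq0.
(* With S the square root of the degree matrix, P = S^-1 N S and 1 p = S^-1 v^T v S. *)
have BE : 1%:M - P + const_mx 1 *m p = invmx S *m B *m S.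
  apply: (can_inj (mulKmx Su)); rewrite !mulmxA mulmxV // mul1mx.
  rewrite /B; move: (transitionE) normalized_adjE; move: (P) (N) => P' N' P'E N'E.
  apply/matrixP => i k; rewrite mul_diag_mx mul_mx_diag !mxE !big_ord1 !mxE.
  rewrite (stationaryE _ hp) P'E N'E mul1r.
  have -> : sdeg i / Num.sqrt volume * (sdeg k / Num.sqrt volume) = sdeg i * sdeg k / volume.
    by rewrite mulf_div -[in LHS]expr2 sqr_sqrtr // ltW // volume_gt0.
  have V0 : volume != 0 by rewrite lt0r_neq0 // volume_gt0.
  case: eqVneq => [->|_]; move: (sdeg_neq0 k) (sdeg_sqr k) (sdeg_neq0 i) (sdeg_sqr i).
    by move: (sdeg k) => b b0 <- _ _; field; rewrite ?b0 ?V0.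
  by move: (sdeg k) (sdeg i) => b a b0 <- a0 <-; rewrite mulr0n; field; rewrite a0 b0 V0.
rewrite /kemeny (@kemeny_fundamental _ _ _ (invmx S *m invmx B *m S)) //.
- rewrite mxtrace_mulC mulmxA mulmxV // mul1mx.
  rewrite (symmetric_trace_resolvent _ defl (Z := invmx B)) ?mulmxV ?deflated_unit //.
  (* The deflated eigenvalue 0 contributes 1, which cancels the - 1 in Kemeny's constant. *)
  + by rewrite big_cons subr0 invr1 addrC addKr.
  + by rewrite raddfB /= normalized_adj_sym trmx_mul trmxK.
  + by rewrite inE oner_eq0.
- exact: transition_ge0.
- exact: transition_row_sum.
- by move=> i; rewrite (stationaryE _ hp) lt0r_neq0 // divr_gt0 ?deg_gt0 // volume_gt0.
- by rewrite BE !mulmxA mulmxK // mulmxK ?deflated_unit // mulVmx.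
Qed.

(** * Test vectors of edges and the extremal spectrum *)

Definition edge_row (i k : 'I_n) : 'rV[R]_n :=
  (Num.sqrt 2)^-1 *: (delta_mx 0 i - delta_mx 0 k).

Lemma edge_row_quadratic (A : 'M[R]_n) i k : A^T = A ->
  (edge_row i k *m A *m (edge_row i k)^T) 0 0 = (A i i + A k k) / 2 - A i k.
Proof.
move=> Asym; rewrite /edge_row linearZ -!scalemxAl -scalemxAr scalerA mxE.
rewrite -invfM -expr2 sqr_sqrtr // linearB /= !trmx_delta mulmxBr !mulmxBl.
by rewrite -!rowE -!colE !mxE -{2}Asym mxE; field.
Qed.

Lemma edge_row_norm i k : i != k -> edge_row i k *m (edge_row i k)^T = 1%:M.
Proof.
move=> ik; apply/matrixP => a b; rewrite !ord1 -[X in X *m _]mulmx1.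
rewrite edge_row_quadratic ?trmx1 // !mxE !eqxx (negbTE ik).
by rewrite !mulr1n mulr0n; field.
Qed.

Lemma edge_row_rayleigh i k : e i k ->
  (edge_row i k *m N *m (edge_row i k)^T) 0 0 = - (Num.sqrt (deg i * deg k))^-1.
Proof.
move=> eik; rewrite edge_row_quadratic ?normalized_adj_sym // !normalized_adjE.
by rewrite !e_irr eik !mul0r addr0 mul0r sub0r mul1r sqrtrM.
Qed.

Lemma edge_neq i k : e i k -> i != k.
Proof. by apply: contraTneq => ->; rewrite e_irr. Qed.

(** Distinct [l] and [m] cannot sit at the same endpoint, so their coordinates never have the same
    nonzero sign. *)
Lemma edge_row_offdiag i k l m : l != m -> ((edge_row i k)^T *m edge_row i k) l m <= 0.
Proof.
move=> lm; rewrite mxE big_ord1 !mxE eqxx /= mulrACA -invfM -expr2 sqr_sqrtr //.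
rewrite pmulr_rle0 ?invr_gt0 //.
have lmN z : ~~ ((l == z) && (m == z)).
  by apply: contra lm => /andP[/eqP-> /eqP->].
move: (lmN i) (lmN k).
case: (l == i); case: (m == i); case: (l == k); case: (m == k) => //= _ _;
by rewrite ?mulr1n ?mulr0n; lra.
Qed.

Lemma spectrum_min_le (s : seq R) (b : R) i k :
  char_poly N = \prod_(a <- s) ('X - a%:P) -> {in s, forall a, b <= a} ->
  e i k -> b <= - (Num.sqrt (deg i * deg k))^-1.
Proof.
move=> Nchar sb eik; rewrite -edge_row_rayleigh //.
have := rayleigh_ge (edge_row i k) normalized_adj_sym Nchar sb.
by rewrite edge_row_norm ?edge_neq // mxE mulr1.
Qed.

(** The edge term takes the shape 1 / (1 - z) with z the Rayleigh quotient of the edge vector, ready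
    for comparison with 1 / (1 - lambda_n). *)
Lemma edge_termE i k : e i k ->
  edge_term R e i k = (1 + (Num.sqrt (deg i * deg k))^-1)^-1.
Proof.
move=> eik; rewrite /edge_term; set t := Num.sqrt _.
have t0 : 0 < t by rewrite sqrtr_gt0 mulr_gt0 ?deg_gt0.
have t1 : t + 1 != 0 by rewrite gt_eqF // addr_gt0.
by field; rewrite t1 gt_eqF.
Qed.

Lemma extremal_spectrum_complete (w : seq R) (b c : R) i k :
  char_poly N = \prod_(a <- 1 :: rcons w b) ('X - a%:P) ->
  {in w, forall a, a = c} -> c < 1 -> b <= c ->
  e i k -> b = - (Num.sqrt (deg i * deg k))^-1 ->
  forall l m, e l m = (l != m).
Proof.
move=> Nchar wc c1 bc eik bE.
(* Shifting by [c] removes every eigenvalue of [w] from the trace. *)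
have trA : \tr ((N - c%:M) *m (N - c%:M)) = (1 - c) ^+ 2 + (b - c) ^+ 2.
  rewrite (symmetric_trace_sqr _ normalized_adj_sym Nchar).
  rewrite big_cons big_rcons /=; congr (_ + _).
  by rewrite big1_seq ?add0r // => a /= /wc->; rewrite subrr expr0n.
have scalar_quad (x : 'rV[R]_n) : x *m x^T = 1%:M ->
    (x *m (N - c%:M) *m x^T) 0 0 = (x *m N *m x^T) 0 0 - c.
  move=> xx; rewrite mulmxBr mulmxBl mul_mx_scalar -scalemxAl xx.
  by move: (N) => N'; rewrite !mxE mulr1.
have vv := perron_row_norm; have xx := edge_row_norm (edge_neq eik).
have AE : N - c%:M = (1 - c) *: (v^T *m v) +
    (b - c) *: ((edge_row i k)^T *m edge_row i k).
  apply: rank2_rigidity => //; rewrite ?subr_ge0 ?subr_le0 ?(ltW c1) //.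
  - by rewrite linearB /= normalized_adj_sym // tr_scalar_mx.
  - by rewrite scalar_quad // -mulmxA perron_row_eigen // vv mxE.
  - by rewrite scalar_quad // edge_row_rayleigh // -bE.
move=> l m; have [->|lm] := eqVneq l m; first exact: e_irr.
have := congr1 (fun A : 'M_n => A l m) AE.
rewrite [LHS]mxE [X in _ + X]mxE [X in - X]mxE (negbTE lm) oppr0 addr0 normalized_adjE.
(* For a non-edge the left side is 0, while v^T v has positive entries and (b - c) x^T x is
   nonnegative off the diagonal. *)
case: (e l m) => //; rewrite mul0r => /esym/eqP; rewrite gt_eqF //.
rewrite mxE ltr_pwDl //.
  rewrite mxE mulr_gt0 ?subr_gt0 // mxE big_ord1 !mxE.
  by rewrite mulr_gt0 // divr_gt0 ?sdeg_gt0 // sqrtr_gt0 volume_gt0.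
by rewrite mxE mulr_le0 ?subr_le0 // edge_row_offdiag.
Qed.

Lemma edge_exists : exists i k, e i k.
Proof.
have i0 : 'I_n by case: n n_ge2 => [|m _] //; exact: ord0.
have /card_gt0P[k] := degree_gt0 i0; rewrite inE => ik.
by exists i0, k.
Qed.

Lemma complete_degree : (forall l m, e l m = (l != m)) -> forall i, deg i = n%:R - 1.
Proof.
move=> ecompl i; rewrite -(natrB R (ltnW n_ge2)) subn1 -[n in n.-1]card_ord.
rewrite -(cardsC1 i) /degree.
by congr (#|pred_of_set _|%:R); apply/setP => k; rewrite !inE ecompl eq_sym.
Qed.

(** The eigen-equation reads (a (n - 1) + 1) y_k = t with [t] independent of [k]. If the factor is
    nonzero, [y] is constant and a = 1, which is excluded from [s]. *)
Lemma complete_spectrum (s : seq R) :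
  (forall l m, e l m = (l != m)) ->
  ordered_spectrum N (1 :: s) -> {in s, forall a, a = - (n%:R - 1)^-1}.
Proof.
move=> ecompl os a sa.
have degE := complete_degree ecompl.
have [s' [[[<-] _ _ s1] _]] := spectrum_head os.
have [_ Nchar] := os; have a1 : a != 1 by apply: contraNneq s1 => <-.
have /eigenvalueP[u uN u0] : eigenvalue N a.
  by rewrite eigenvalue_root_char Nchar root_prod_XsubC inE sa orbT.
pose y i := u 0 i / sdeg i; pose t := \sum_i y i.
have yE k : (a * (n%:R - 1) + 1) * y k = t.
  have := eigen_row_harmonic uN k; rewrite -/(y k) degE => H.
  rewrite mulrDl mul1r H /t (bigD1 k) //= ecompl eqxx mul0r add0r addrC.
  rewrite [in RHS](bigD1 k) //=; congr (_ + _).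
  apply: eq_bigr => i ik.
  by rewrite ecompl ik mul1r.
have n1 : n%:R - 1 != 0 :> R by rewrite subr_eq0 (eqr_nat R n 1) gtn_eqF.
suff /eqP : a * (n%:R - 1) + 1 == 0.
  by move/eqP; rewrite addr_eq0 => /eqP aE; apply: (mulIf n1); rewrite aE mulNr mulVf.
apply: contraNT a1 => c0; have yc i k : y i = y k by apply: (mulfI c0); rewrite !yE.
have /rV0Pn[i ui] := u0.
have yi : y i != 0 by rewrite mulf_neq0 // invr_eq0 sdeg_neq0.
have := yE i; rewrite /t; under eq_bigr do rewrite (yc _ i).
rewrite sumr_const card_ord -[y i *+ n]mulr_natl => /(mulIf yi) H.
by apply/eqP; apply: (mulIf n1); apply: (addIr 1); rewrite H mul1r subrK.
Qed.

End Graph.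

(** * The bound and its equality case *)

Lemma sum_le_eq (R : numDomainType) (T : eqType) (s : seq T) (f : T -> R) (M x y : R) :
  {in s, forall a, f a <= M} -> x <= y ->
  \sum_(a <- s) f a + x <= y + (size s)%:R * M /\
  (\sum_(a <- s) f a + x = y + (size s)%:R * M -> x = y /\ {in s, forall a, f a = M}).
Proof.
move=> fM xy.
(* The gap is a sum of nonnegative defects, so equality makes each of them vanish. *)
have defect : y + (size s)%:R * M - (\sum_(a <- s) f a + x) =
    \sum_(a <- s) (M - f a) + (y - x).
  by rewrite sumrB big_const_seq count_predT iter_addr_0 mulr_natl; ring.
have nn : 0 <= \sum_(a <- s) (M - f a).
  by rewrite big_seq; apply: sumr_ge0 => a /fM; rewrite subr_ge0.
split; first by rewrite -subr_ge0 defect addr_ge0 ?subr_ge0.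
move=> eqs; have /eqP := defect; rewrite eqs subrr eq_sym paddr_eq0 ?subr_ge0 //.
move=> /andP[S0 /eqP yx]; split; first by apply/eqP; rewrite eq_sym -subr_eq0 yx.
move=> a sa; apply/eqP; rewrite eq_sym -subr_eq0.
move: S0; rewrite big_seq psumr_eq0 => [/allP/(_ a sa)|b /fM]; last by rewrite subr_ge0.
by rewrite sa.
Qed.

Theorem corollary5p6 (R : realType) (n : nat) (e : rel 'I_n)
    (p : 'rV[R]_n) (lambda : seq R) (j : 'I_n)
    (hn : (2 <= n)%N)
    (hsimple : simple_graph e)
    (hconn : connected_graph e)
    (hp : stationary_distribution (transition_mx R e) p)
    (hlambda : ordered_spectrum (normalized_adj_mx R e) lambda) :
  (kemeny e p j <=
    (min_edge_term R e + (n%:R - 2) / (1 - lambda`_1))%:E)%E /\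
  (kemeny e p j = (min_edge_term R e + (n%:R - 2) / (1 - lambda`_1))%:E <->
    graph_iso e (@complete_graph n)).
Proof.
have [e_sym e_irr] := hsimple.
have [s [[lE s_sorted s_size s1] _]] := spectrum_head hn e_sym hconn hlambda.
have Nchar := hlambda.2; have s_le1 := spectrum_le1 hn e_sym hconn Nchar.
rewrite {lambda}lE in hlambda Nchar s_le1 *.
(* [c] is lambda_2; [s] has n - 1 >= 1 entries, so the default of [nth] does not occur. *)
rewrite (kemeny_spectral hn e_sym hconn _ hp hlambda) lee_fin [(1 :: s)`_1]/=; set c := s`_0.
have s_lt1 a : a \in s -> a < 1.
  move=> sa; rewrite lt_neqAle s_le1 ?inE ?sa ?orbT // andbT.
  by apply: contraNneq s1 => <-.
have nE : n%:R - 2 = (n - 2)%:R :> R by rewrite natrB.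
(* Split off the least eigenvalue [b], leaving n - 2 others in [w]; for n = 2 [w] is empty and b =
   c. *)
have sE : s = rcons (take (n - 2) s) (last c s).
  have ss : size s = (n - 2).+1 by rewrite s_size; lia.
  rewrite -nth_last ss /= -take_nth ?ss // take_oversize // ss //.
set w := take _ s in sE; set b := last c s in sE.
have w_size : size w = (n - 2)%N by rewrite size_takel // s_size; lia.
have c_s : c \in s by rewrite mem_nth // s_size; lia.
have b_s : b \in s by rewrite sE mem_rcons mem_head.
have s_le a : a \in s -> a <= c.
  rewrite /c; case: (s) s_sorted => // a0 s'; rewrite /= (path_sortedE (rev_trans le_trans)).
  by move=> /andP[/allP H _]; rewrite inE => /predU1P[->//|/H].
have s_ge a : a \in s -> b <= a.
  move: s_sorted; rewrite {1}sE -[rcons _ _]revK rev_sorted rev_rcons /=.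
  rewrite path_sortedE; last exact: le_trans.
  by rewrite sE mem_rcons inE => /andP[/allP H _] /predU1P[->//|aw]; apply: H; rewrite mem_rev.
have [i0 [k0 eik0]] := edge_exists hn hconn.
(* From here on i ~ k is an edge attaining the minimum. *)
have [[i [k [eik muE]]] _] := min_edge_termP R eik0.
have bmin : b <= - (Num.sqrt ((degree e i)%:R * (degree e k)%:R))^-1.
  apply: (spectrum_min_le e_sym e_irr Nchar _ eik) => a; rewrite inE.
  by case/predU1P => [->|/s_ge //]; exact: s_le1 (mem_behead _).
have muE' := muE; rewrite (edge_termE R hn hconn eik) in muE'.
set t := (Num.sqrt _)^-1 in bmin muE'.
have t0 : 0 <= t by rewrite invr_ge0 sqrtr_ge0.
have b_bound : (1 - b)^-1 <= min_edge_term R e.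
  have b1 : 0 < 1 - b by rewrite subr_gt0 s_lt1.
  have t1 : 0 < 1 + t by rewrite ltr_pwDl.
  by rewrite muE' lef_pV2 ?posrE // lerD2l lerNr.
have w_bound : {in w, forall a, (1 - a)^-1 <= (1 - c)^-1}.
  move=> a aw; have sa : a \in s by rewrite sE mem_rcons inE aw orbT.
  by rewrite lef_pV2 ?posrE ?subr_gt0 ?s_lt1 // lerD2l lerN2 s_le.
have sumE : \sum_(a <- s) (1 - a)^-1 = \sum_(a <- w) (1 - a)^-1 + (1 - b)^-1.
  by rewrite {1}sE big_rcons.
have [Kle Keq] := sum_le_eq w_bound b_bound.
rewrite sumE nE -w_size; split=> //; split.
  (* Equality saturates every termwise bound; injectivity of z |-> 1 / (1 - z) then gives w = c
     throughout and b = - t. *)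
  move=> [/Keq[bE wE]].
  exists id; split; first by exists id.
  move=> l m; apply/esym.
  apply: (extremal_spectrum_complete hn e_sym e_irr hconn
    (w := w) (b := b) (c := c)) eik _ l m.
  - by rewrite -sE.
  - by move=> a /wE/invr_inj/addrI/oppr_inj.
  - exact: s_lt1.
  - exact: s_le.
  - rewrite -/t; have /invr_inj/addrI <- : (1 - b)^-1 = (1 + t)^-1 by rewrite bE muE'.
    by rewrite opprK.
case=> f [f_bij fE]; congr EFin.
have ecompl l m : e l m = (l != m).
  by rewrite -fE /complete_graph (inj_eq (bij_inj f_bij)).
have sval := complete_spectrum hn e_sym hconn ecompl hlambda.
have n1 : 0 < n%:R - 1 :> R by rewrite subr_gt0 ltr1n.
(* All degrees are n - 1, so t = 1 / (n - 1), and all of [s] equals - 1 / (n - 1): both sides agree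
   term by term. *)
rewrite muE' /t !(complete_degree R hn ecompl) -expr2 sqrtr_sqr gtr0_norm //.
rewrite (sval b b_s) opprK addrC; congr (_ + _).
rewrite (eq_big_seq (fun=> (1 - c)^-1)) => [|a aw]; last first.
  by rewrite (sval c c_s) (sval a) // sE mem_rcons inE aw orbT.
by rewrite big_const_seq count_predT iter_addr_0 mulr_natl.
Qed.
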